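(* Let $(c(n))_{n\in\mathbb{N}^*}$ be a nondecreasing sequence of positive real numbers such that $$\forall n\in\mathbb{N}^*,\quad \log n\leq c(n)\leq \sqrt{n},$$ and suppose that $c(2n)=\Theta(c(n))$ as $n\to\infty$. Then there exist an increasing sequence of integers $(N(n))_{n\in\mathbb{N}^*}$ and, for each $n$, a non trivial monotone symmetric subset $C_n\subset\{0,1\}^{N(n)}$ such that: (i) the threshold of $C=(C_n)$ is located at $1/2$: for every $\varepsilon\in\,]0,1[$, $p_{C_n,\varepsilon}\to \frac12$ as $n\to\infty$; (ii) the threshold width of $C$ is of order $1/c(N(n))$: for every $\varepsilon\in\,]0,1/2[$, $\tau(C_n,\varepsilon)=\Theta\left(\frac{1}{c(N(n))}\right)$ as $n\to\infty$.
   Context: $\mathbb{N}^*$ is the set of positive integers and $\log$ is the natural logarithm. For positive sequences, $u_n=\Theta(v_n)$ means that there are constants $0<c_1\le c_2$ with $c_1v_n\le u_n\le c_2v_n$ for all sufficiently large $n$ (the constants may depend on $\varepsilon$). For $p\in[0,1]$, $\mu_{N,p}$ (also written $\mu_p$) is the product of $N$ Bernoulli measures of parameter $p$ on $\{0,1\}^N$: $\mu_{N,p}(x)=p^{\sum_i x_i}(1-p)^{\sum_i(1-x_i)}$. A subset $A\subset\{0,1\}^N$ is monotone if $x\in A$ and $x\preceq y$ imply $y\in A$, where $\preceq$ is the coordinatewise partial order. It is non trivial if $A\neq\emptyset$ and $A\ne\{0,1\}^N$. For non trivial monotone $A$, $p\mapsto\mu_p(A)$ is an increasing bijection of $[0,1]$;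 for $\alpha\in[0,1]$, $p_{A,\alpha}$ is the unique real in $[0,1]$ with $\mu_{p_{A,\alpha}}(A)=\alpha$. For $\varepsilon\in\,]0,1/2]$, the threshold width of $A$ at level $\varepsilon$ is $\tau(A,\varepsilon)=p_{A,1-\varepsilon}-p_{A,\varepsilon}$. A subset $A\subset\{0,1\}^N$ is symmetric if there is a subgroup $G$ of the permutation group $\mathcal{S}_N$ acting transitively on $\{1,\ldots,N\}$ such that for all $g\in G$ and $x\in A$, $g.x=(x_{g^{-1}(1)},\ldots,x_{g^{-1}(N)})\in A$. *)

(* Defs.v *)
From HB Require Import structures.
From mathcomp Require Import all_boot all_order all_algebra all_fingroup.
From mathcomp Require Import all_classical all_reals all_analysis.

Set Implicit Arguments.
Unset Strict Implicit.
Unset Printing Implicit Defensive.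

Import Order.TTheory GRing.Theory Num.Theory.
Import numFieldNormedType.Exports.

Local Open Scope ring_scope.

(* The discrete cube {0,1}^N; coordinates are indexed by 'I_N, that is by
   0, ..., N - 1 instead of 1, ..., N. *)
Notation cube N := {ffun 'I_N -> bool}.

(* The exponents are the numbers of ones and of zeros of x (bool is coerced
   to nat). *)
Definition mu_pt (R : realType) (N : nat) (p : R) (x : cube N) : R :=
  p ^+ (\sum_(i < N) x i)%N * (1 - p) ^+ (\sum_(i < N) (1 - x i))%N.

Definition mu (R : realType) (N : nat) (p : R) (A : {set cube N}) : R :=
  \sum_(x in A) mu_pt p x.

Definition cube_le (N : nat) (x y : cube N) : Prop :=
  forall i : 'I_N, (x i <= y i)%N.

Definition monotone_set (N : nat) (A : {set cube N}) : Prop :=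
  forall x y : cube N, x \in A -> cube_le x y -> y \in A.

(* Classical sets also define set0, hence the qualified name. *)
Definition nontrivial_set (N : nat) (A : {set cube N}) : Prop :=
  A <> finset.set0 /\ A <> [set: cube N].

Definition perm_cube (N : nat) (g : {perm 'I_N}) (x : cube N) : cube N :=
  [ffun i => x ((g^-1)%g i)].

Definition symmetric_set (N : nat) (A : {set cube N}) : Prop :=
  exists G : {group {perm 'I_N}},
    [transitive G, on [set: 'I_N] | 'P] /\
    (forall (g : {perm 'I_N}) (x : cube N),
       g \in G -> x \in A -> perm_cube g x \in A).

(* p_{A,alpha}. For A non trivial and monotone and alpha in [0,1] the set
   below is a singleton; in the other cases the value is irrelevant. *)
Definition p_level (R : realType) (N : nat) (A : {set cube N}) (alpha : R) : R :=
  get [set p : R | 0 <= p <= 1 /\ mu p A = alpha]%classic.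

Definition threshold_width (R : realType) (N : nat) (A : {set cube N})
    (eps : R) : R :=
  p_level A (1 - eps) - p_level A eps.

Definition Theta_seq (R : realType) (u v : nat -> R) : Prop :=
  exists c1 c2 : R, [/\ 0 < c1, c1 <= c2 &
    exists n0 : nat, forall n : nat, (n0 <= n)%N ->
      c1 * v n <= u n <= c2 * v n].

(* Main.v *)
Require Import Defs.
From mathcomp Require Import all_boot all_order all_algebra all_fingroup.
From mathcomp Require Import all_classical all_reals all_analysis.
From mathcomp Require Import polyrcf ring lra zify.

Set Implicit Arguments.
Unset Strict Implicit.
Unset Printing Implicit Defensive.

Import Order.TTheory GRing.Theory Num.Theory.
Import numFieldNormedType.Exports.

Local Open Scope classical_set_scope.
Local Open Scope ring_scope.

(** The sets are tribes of majorities.  Take s = 2 ^ r tribes, each made of r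
committees of k = 2l+1 voters; a configuration belongs to C when some tribe
has all its committees won by a majority of ones.  If h(p) is the probability
that one committee is won, then mu_p(C) = F(p) with
F = 1 - (1 - h^r)^s.

The tribes part T(q) = 1 - (1 - q^r)^s has, with s = 2 ^ r, its threshold near
1/2 and a slope of order r there: [tribes_slope_upper] gives T' <= 4r, and
[tribes_slope_lower] gives T' >= r T (1 - T).  The majority part has
h(1/2) = 1/2 and a slope of order sqrt k: the maximal slope, at 1/2, is a
central binomial coefficient ([majority_peak]), and
[majority_slope_lower] shows that h' stays of order sqrt k as long as h stays
away from 0 and 1.  Since intermediate values of T force intermediate values
of q, uniformly in r ([tribes_level]), the chain rule gives, on every band
eta <= F <= 1 - eta, a slope F' between two multiples of S = r sqrt k
([profile_increment]).  Hence the width of the threshold is of order 1/S.  As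
1/4 <= F(1/2) <= 3/4, every level is also at distance O(1/S) from 1/2.

What remains is to reach S of order c(N), with N = 2^r r k.  Since
S^2 = N r / 2^r, for N close to a prescribed M this asks that r / 2^r be of
order c(M)^2 / M.  The ratio r / 2^r at most halves when r
increases by one, so the least r with r / 2^r <= c(M)^2 / M is right up to a
factor 2 ([tribe_size_exists]); here c(M) <= sqrt M covers the case r = 1, and
c(M) >= log M ensures that 2^r r = O(M), so that there is room for at least
one voter per committee.  Taking M = 16^n gives M < N <= 10 M
([parameters_exist]), so N is increasing in n, and the doubling condition
makes c(N) comparable with c(M). *)

(** * Bernoulli inequalities and the tribes function *)

Section Bernoulli.
Context {R : realFieldType}.
Implicit Types x : R.

Lemma bernoulli_add n x : 0 <= x -> 1 + n%:R * x <= (1 + x) ^+ n.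
Proof.
move=> x0; elim: n => [|n IH]; first by rewrite expr0; lra.
rewrite exprS -natr1; apply: le_trans (ler_wpM2l _ IH); last by lra.
have n0 : 0 <= n%:R :> R by []; nra.
Qed.

Lemma bernoulli_sub n x : 0 <= x <= 1 -> 1 - n%:R * x <= (1 - x) ^+ n.
Proof.
move=> /andP[x0 x1]; elim: n => [|n IH]; first by rewrite expr0; lra.
rewrite exprS -natr1; apply: le_trans (ler_wpM2l _ IH); last by lra.
have n0 : 0 <= n%:R :> R by []; nra.
Qed.

Lemma bernoulli_sub_upper n x : 0 <= x <= 1 ->
  (1 - x) ^+ n * (1 + n%:R * x) <= 1.
Proof.
move=> /andP[x0 x1]; apply: (@le_trans _ _ ((1 - x) ^+ n * (1 + x) ^+ n)).
  by apply: ler_wpM2l; [apply: exprn_ge0; lra | exact: bernoulli_add].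
rewrite -exprMn; apply: exprn_ile1; nra.
Qed.
End Bernoulli.

Section Tribes.
Context {R : realFieldType}.
Implicit Types q eta : R.

(** The probability that, among s tribes of r independent committees that are
each won with probability q, at least one tribe wins all its committees. *)
Definition tribes_prob r s q : R := 1 - (1 - q ^+ r) ^+ s.
(** The derivative of [tribes_prob r s]. *)
Definition tribes_slope r s q : R :=
  r%:R * (s%:R * q ^+ r.-1 * (1 - q ^+ r) ^+ s.-1).

Lemma expr_01 n q : 0 <= q <= 1 -> 0 <= q ^+ n <= 1.
Proof. by move=> /andP[q0 q1]; rewrite exprn_ge0 //= exprn_ile1. Qed.

Lemma expr_1B_01 r s q : 0 <= q <= 1 -> 0 <= (1 - q ^+ r) ^+ s <= 1.
Proof. by move=> /(expr_01 r) /andP[y0 y1]; apply: expr_01; lra. Qed.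

Lemma tribes_slope_ge0 r s q : 0 <= q <= 1 -> 0 <= tribes_slope r s q.
Proof.
move=> q01; have /andP[? _] := expr_01 r.-1 q01.
have /andP[? _] := expr_1B_01 r s.-1 q01.
by rewrite /tribes_slope !mulr_ge0.
Qed.

(** For q >= 1/2, the factor s q^r (1 - q^r)^(s-1) is bounded, by
[bernoulli_sub_upper]; for q <= 1/2, the choice s = 2 ^ r makes
s q^(r-1) = 2 (2q)^(r-1) bounded. *)
Lemma tribes_slope_upper r q : (0 < r)%N -> 0 <= q <= 1 ->
  tribes_slope r (2 ^ r) q <= 4 * r%:R.
Proof.
move=> r0 q01; rewrite mulrC ler_wpM2l //.
case: r r0 => // r _; set s := (2 ^ r.+1)%N; rewrite -pred_Sn.
have /andP[z0 z1] := expr_1B_01 r.+1 s.-1 q01.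
have /andP[y0 y1] := expr_01 r.+1 q01.
have /andP[u0 u1] := expr_01 r q01.
case: (leP q 2^-1) => hq.
  apply: (@le_trans _ _ (2 * (2 * q) ^+ r)).
    rewrite /s natrX exprMn mulrA -exprS; apply: ler_piMr => //.
    by rewrite mulr_ge0 // exprn_ge0.
  have : (2 * q) ^+ r <= 1 by apply: exprn_ile1; lra.
  lra.
have sS : s%:R = s.-1%:R + 1 :> R by rewrite natr1 prednK // expn_gt0.
have s1 : 1 <= s.-1%:R :> R.
  by rewrite ler1n -ltnS prednK ?expn_gt0 // (leq_exp2l 1).
have B := bernoulli_sub_upper s.-1 (expr_01 r.+1 q01).
set y := q ^+ r.+1 in B y0 y1 z0 z1 *; set z := (1 - y) ^+ s.-1 in B z0 z1 *.
have yE : y = q * q ^+ r by rewrite /y exprS.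
have szy : s%:R * y * z <= 2 by rewrite sS; nra.
have w0 : 0 <= s%:R * q ^+ r * z by rewrite !mulr_ge0.
have : q * (s%:R * q ^+ r * z) <= 2 by apply: le_trans szy; rewrite yE; lra.
nra.
Qed.

(** With v = (1 - q^r)^s, Bernoulli's inequality gives s q^r >= 1 - v, and the
slope is at least r (s q^r) v. *)
Lemma tribes_slope_lower r s q : (0 < r)%N -> (0 < s)%N -> 0 <= q <= 1 ->
  r%:R * (tribes_prob r s q * (1 - tribes_prob r s q)) <= tribes_slope r s q.
Proof.
move=> r0 s0 q01; rewrite /tribes_slope /tribes_prob ler_wpM2l //.
have B := bernoulli_sub s (expr_01 r q01).
have /andP[z0 z1] := expr_1B_01 r s q01.
have /andP[t0 t1] := expr_1B_01 r s.-1 q01.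
have /andP[y0 y1] := expr_01 r q01.
have /andP[u0 u1] := expr_01 r.-1 q01.
have vt : (1 - q ^+ r) ^+ s <= (1 - q ^+ r) ^+ s.-1.
  by rewrite -[in leLHS](prednK s0) exprS ler_piMl //; lra.
have yu : q ^+ r <= q ^+ r.-1.
  by rewrite -[in leLHS](prednK r0) exprS ler_piMl //; lra.
apply: (@le_trans _ _ (s%:R * q ^+ r * (1 - q ^+ r) ^+ s)); first nra.
by rewrite ler_pM ?mulr_ge0 // ler_wpM2l.
Qed.

(** The lower bound comes from T(q) <= s q^r = (2q)^r.  For the upper bound,
if q >= 3/4 then 1 - T(q) <= 1 / (1 + (2q)^r) decays with r, so a level at
most 1 - eta forces r = O(1/eta); then 1 - T(q) <= 1 - q^r <= r (1 - q)
keeps q away from 1. *)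
Lemma tribes_level r q eta : (0 < r)%N -> 0 <= q <= 1 -> 0 < eta <= 2^-1 ->
  eta <= tribes_prob r (2 ^ r) q <= 1 - eta ->
  eta ^+ 2 / 4 <= q <= 1 - eta ^+ 2 / 4.
Proof.
move=> r0 q01 /andP[e0 e2] /andP[Tl Tu].
have [q0 q1] := andP q01.
have r1 : 1 <= r%:R :> R by rewrite ler1n.
have sy : (2 ^ r)%:R * q ^+ r = (2 * q) ^+ r by rewrite natrX exprMn.
have B := bernoulli_sub (2 ^ r) (expr_01 r q01).
have B' := bernoulli_sub_upper (2 ^ r) (expr_01 r q01).
have /andP[z0 z1] := expr_1B_01 r (2 ^ r) q01.
have /andP[y0 y1] := expr_01 r q01.
rewrite /tribes_prob in Tl Tu; rewrite sy in B B'.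
apply/andP; split.
  have ltq : eta <= 2 * q; last by nra.
  case: (leP (2 * q) 1) => hq; last by lra.
  apply: (@le_trans _ _ ((2 * q) ^+ r)); first by lra.
  by rewrite -(prednK r0) exprS ler_piMr ?exprn_ile1 //; lra.
case: (leP q (3 / 4)) => hq; first by nra.
have hr : r%:R * eta <= 2.
  have C : 1 + r%:R * (2 * q - 1) <= (1 + (2 * q - 1)) ^+ r.
    by apply: bernoulli_add; lra.
  rewrite addrCA subrr addr0 in C.
  have : eta * (1 + r%:R * (2 * q - 1)) <= 1.
    apply: le_trans B'; apply: ler_pM; try lra; nra.
  have : 0 <= (r%:R * eta) * (2 * q - 3 / 2) by rewrite !mulr_ge0 //; lra.
  lra.
have vy : (1 - q ^+ r) ^+ (2 ^ r) <= 1 - q ^+ r.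
  rewrite -[in leLHS](prednK (_ : 0 < 2 ^ r)%N) ?expn_gt0 // exprS.
  by rewrite ler_piMr ?exprn_ile1 //; lra.
have D : 1 - r%:R * (1 - q) <= (1 - (1 - q)) ^+ r.
  by apply: bernoulli_sub; lra.
have e1 : eta <= r%:R * (1 - q) by rewrite subKr in D; lra.
have : eta * eta <= 2 * (1 - q).
  apply: le_trans (_ : eta * (r%:R * (1 - q)) <= _); first by nra.
  rewrite mulrCA mulrA ler_wpM2r //; lra.
rewrite expr2; lra.
Qed.

(** At q = 1/2 the value is 1 - (1 - 1/s)^s, which is near 1 - 1/e. *)
Lemma tribes_half r : (0 < r)%N ->
  1 / 4 <= tribes_prob r (2 ^ r) (2^-1 : R) <= 3 / 4.
Proof.
case: r => // r _; rewrite /tribes_prob exprVn -natrX.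
set s := (2 ^ r)%N.
have s1 : 1 <= s%:R :> R by rewrite ler1n expn_gt0.
rewrite expnS -/s natrM.
have y01 : 0 <= (2 * s%:R : R)^-1 <= 1.
  by rewrite invr_ge0 mulr_ge0 //= ?invf_le1; lra.
have := bernoulli_sub_upper (2 * s)%N y01; have := bernoulli_sub s y01.
have -> : s%:R * (2 * s%:R)^-1 = 2^-1 :> R by field; lra.
rewrite natrM mulfV; last by lra.
rewrite mulnC exprM.
set z := (1 - _) ^+ s => zl zu; nra.
Qed.
End Tribes.

(** * Binomial tails and the majority function *)

Section BinomialTail.
Context {R : comNzRingType}.

(** The probability, as a polynomial in p, that a binomial variable of
parameters n and p is at least a. *)
Definition binomial_tail n a : {poly R} :=
  \sum_(a <= j < n.+1) ('X^j * (1 - 'X) ^+ (n - j)) *+ 'C(n, j).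

(** The derivative of the j-th term is a difference of two consecutive terms of
a sequence, so the sum telescopes. *)
Lemma deriv_binomial_tail n a : (a <= n)%N ->
  (binomial_tail n.+1 a.+1)^`() =
  ('X^a * (1 - 'X) ^+ (n - a)) *+ (n.+1 * 'C(n, a)).
Proof.
move=> lean; rewrite /binomial_tail big_add1 /= raddf_sum /=.
pose g i : {poly R} := ('X^i * (1 - 'X) ^+ (n - i)) *+ (n.+1 * 'C(n, i)).
have gE i : (a <= i < n.+1)%N ->
    deriv (('X^(i.+1) * (1 - 'X) ^+ (n.+1 - i.+1)) *+ 'C(n.+1, i.+1)) =
    - (g i.+1 - g i).
  rewrite ltnS => /andP[_ lein].
  rewrite subSS derivMn derivM derivXn deriv_exp derivB derivC derivX sub0r.
  rewrite mulN1r mulNrn mulrN mulrnDl mulNrn mulrnAl -!mulrnA mulrnAr -mulrnA.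
  rewrite -subnS /g opprB; congr (_ *+ _ - _ *+ _).
  - by rewrite -mul_bin_diag.
  - by rewrite mul_bin_down subSS.
rewrite (eq_big_nat _ _ gE) sumrN telescope_sumr ?leqW // opprB.
by rewrite {2}/g bin_small ?muln0 ?mulr0n ?subr0.
Qed.

Lemma binomial_tail_sum n p : (binomial_tail n 0).[p] = 1.
Proof.
rewrite /binomial_tail big_mkord horner_sum -[RHS](expr1n _ n).
rewrite -[in RHS](subrK p 1) exprDn; apply: eq_bigr => i _.
by rewrite hornerMn !hornerE mulrC.
Qed.

Lemma horner_binomial_tail n a p : (binomial_tail n a).[p] =
  \sum_(a <= j < n.+1) (p ^+ j * (1 - p) ^+ (n - j)) *+ 'C(n, j).
Proof.
rewrite horner_sum; apply: eq_bigr => i _.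
by rewrite hornerMn !hornerE.
Qed.

Lemma binomial_tail_compl l p :
  (binomial_tail (2 * l).+1 l.+1).[1 - p] =
  1 - (binomial_tail (2 * l).+1 l.+1).[p].
Proof.
apply: (addIr (binomial_tail (2 * l).+1 l.+1).[p]); rewrite subrK.
rewrite -[RHS](binomial_tail_sum (2 * l).+1 p) !horner_binomial_tail.
rewrite [in RHS](@big_cat_nat _ _ _ l.+1) //=; last by lia.
congr (_ + _).
(* Reversing the summation turns the tail above l into the head up to l. *)
rewrite big_nat_rev /= -[l.+1 in LHS]add0n big_addn.
have -> : ((2 * l).+2 - l.+1 = l.+1)%N by lia.
rewrite [LHS]big_nat_cond [RHS]big_nat_cond.
apply: eq_bigr => i; rewrite andbT => /andP[_ il].
have -> : (l.+1 + (2 * l).+2 - (i + l.+1).+1 = (2 * l).+1 - i)%N by lia.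
have il2 : (i <= (2 * l).+1)%N by lia.
by rewrite subKr bin_sub // subKn // mulrC.
Qed.

End BinomialTail.

Section Majority.
Context {R : rcfType}.
Implicit Types p : R.

Definition majority_poly l : {poly R} := binomial_tail (2 * l).+1 l.+1.
Definition majority_slope l p : R :=
  ((2 * l).+1 * 'C(2 * l, l))%:R * (p * (1 - p)) ^+ l.
(** The probability that 2l fair coins give exactly l heads. *)
Definition central_ratio l : R := 'C(2 * l, l)%:R / 4 ^+ l.

Lemma deriv_majority l p : (majority_poly l)^`().[p] = majority_slope l p.
Proof.
rewrite deriv_binomial_tail ?mul2n -?addnn ?leq_addr // addnK.
by rewrite -exprMn hornerMn !hornerE -mulr_natl addnn -mul2n.
Qed.

Lemma majority_0 l : (majority_poly l).[0] = 0.
Proof.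
rewrite horner_binomial_tail big_nat big1 // => i /andP[i0 _].
by rewrite -(ltn_predK i0) exprS !mul0r mul0rn.
Qed.

Lemma majority_1 l : (majority_poly l).[1] = 1.
Proof. by rewrite -[1 in LHS]subr0 binomial_tail_compl majority_0 subr0. Qed.

Lemma majority_half l : (majority_poly l).[2^-1] = 2^-1.
Proof.
have := binomial_tail_compl l (2^-1 : R).
have -> : 1 - 2^-1 = 2^-1 :> R by field.
rewrite -/(majority_poly l); lra.
Qed.

Lemma majority_slope_ge0 l p : 0 <= p <= 1 -> 0 <= majority_slope l p.
Proof.
move=> /andP[p0 p1]; rewrite mulr_ge0 // exprn_ge0 // mulr_ge0 //; lra.
Qed.

Lemma majority_nondecreasing l : {in `[0, 1] &,
  {homo horner (majority_poly l) : x y / x <= y}}.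
Proof.
apply: ler_hornerW => x; rewrite in_itv /= => /andP[x0 x1].
by rewrite deriv_majority majority_slope_ge0 //; lra.
Qed.

Lemma majority_01 l p : 0 <= p <= 1 -> 0 <= (majority_poly l).[p] <= 1.
Proof.
move=> p01; have [p0 p1] := andP p01.
rewrite -{1}(majority_0 l) -(majority_1 l).
by rewrite !majority_nondecreasing // in_itv /= ?lexx ?ler01.
Qed.

Lemma bin_central_rec l :
  (l.+1 * 'C(2 * l.+1, l.+1) = 2 * (2 * l).+1 * 'C(2 * l, l))%N.
Proof.
have h1 := mul_bin_diag (2 * l.+1) l.
have e : (2 * l.+1).-1 = (2 * l).+1 by lia.
rewrite e in h1.
have h2 := mul_bin_down (2 * l).+1 l; rewrite /= in h2.
have e2 : ((2 * l).+1 - l = l.+1)%N by lia.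
rewrite e2 in h2; nia.
Qed.

Lemma central_ratio_rec l :
  (2 * l.+1)%:R * central_ratio l.+1 = (2 * l).+1%:R * central_ratio l.
Proof.
rewrite /central_ratio exprS.
have := congr1 (fun n => n%:R : R) (bin_central_rec l).
rewrite !natrM; set b := 'C(_, _)%:R; set a := 'C(_, _)%:R => h.
have e4 : (4 : R) ^+ l != 0 by rewrite expf_neq0 ?pnatr_eq0.
transitivity (2 * (l.+1%:R * b) / (4 * 4 ^+ l)); first by field.
by rewrite h; field.
Qed.

(** By [central_ratio_rec], the two expressions are respectively nondecreasing
and nonincreasing in l, and both equal 1 at l = 0.  They replace Stirling's
formula. *)
Lemma central_ratio_bounds l :
  1 <= central_ratio l ^+ 2 * (4 * l%:R + 1) /\
  central_ratio l ^+ 2 * (2 * l%:R + 1) <= 1.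
Proof.
elim: l => [|l [IH1 IH2]].
  by rewrite /central_ratio muln0 bin0 expr0 divr1 expr1n; split; lra.
have := central_ratio_rec l.
have l0 : 0 <= l%:R :> R by [].
set a := central_ratio l in IH1 IH2 *; set b := central_ratio l.+1.
have -> : (2 * l.+1)%:R = 2 * (l%:R + 1) :> R by rewrite natrM natr1.
have -> : (2 * l).+1%:R = 2 * l%:R + 1 :> R by rewrite -natr1 natrM.
rewrite -[l.+1%:R]natr1 => h.
have h2 : 4 * (l%:R + 1) ^+ 2 * b ^+ 2 = (2 * l%:R + 1) ^+ 2 * a ^+ 2.
  have -> : 4 * (l%:R + 1) ^+ 2 * b ^+ 2 = (2 * (l%:R + 1) * b) ^+ 2 by ring.
  by rewrite h; ring.
have m0 : 0 < 4 * (l%:R + 1) ^+ 2 :> R by rewrite mulr_gt0 // exprn_gt0 //; lra.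
split.
- rewrite -(ler_pM2l m0) mulr1 [X in _ <= X]mulrA h2.
  set x := (l%:R : R) in l0 *.
  have : 4 * (x + 1) ^+ 2 * (4 * x + 1) <= (2 * x + 1) ^+ 2 * (4 * (x + 1) + 1).
    by rewrite -subr_ge0 [X in 0 <= X](_ : _ = 1) //; ring.
  have : 0 <= (2 * x + 1) ^+ 2 by rewrite sqr_ge0.
  nra.
- rewrite -(ler_pM2l m0) mulr1 [X in X <= _]mulrA h2.
  set x := (l%:R : R) in l0 *.
  have : (2 * x + 1) * (2 * (x + 1) + 1) <= 4 * (x + 1) ^+ 2.
    by rewrite -subr_ge0 [X in 0 <= X](_ : _ = 1) //; ring.
  nra.
Qed.

(** This form shows how the slope decays with the distance of p to 1/2. *)
Lemma majority_slopeE l p : majority_slope l p =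
  (2 * l).+1%:R * central_ratio l * (1 - (2 * p - 1) ^+ 2) ^+ l.
Proof.
rewrite /majority_slope /central_ratio natrM -!mulrA; congr (_ * (_ * _)).
have -> : 1 - (2 * p - 1) ^+ 2 = 4 * (p * (1 - p)) by ring.
by rewrite [in RHS]exprMn mulKf // expf_neq0 ?pnatr_eq0.
Qed.

Lemma majority_peak l :
  Num.sqrt (2 * l).+1%:R / 2 <= (2 * l).+1%:R * central_ratio l
  <= Num.sqrt (2 * l).+1%:R.
Proof.
set k : R := (2 * l).+1%:R; have [h1 h2] := central_ratio_bounds l.
have kE : k = 2 * l%:R + 1 by rewrite /k -natr1 natrM.
have l0 : 0 <= l%:R :> R by [].
have k0 : 0 <= k by rewrite kE; lra.
have a0 : 0 <= central_ratio l by rewrite divr_ge0 // exprn_ge0.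
have s0 := sqrtr_ge0 k.
have sE := sqr_sqrtr k0.
set a := central_ratio l in a0 h1 h2 *; set s := Num.sqrt k in s0 sE *.
have h3 : (k * a) ^+ 2 <= k by rewrite exprMn expr2; nra.
have h4 : k <= 2 * (k * a) ^+ 2 by rewrite exprMn expr2; nra.
have ka0 : 0 <= k * a by rewrite mulr_ge0.
apply/andP; split.
  rewrite -ler_sqr ?nnegrE ?divr_ge0 // expr_div_n sE.
  lra.
by rewrite -ler_sqr ?nnegrE // sE.
Qed.

Lemma majority_slope_upper l p : 0 <= p <= 1 ->
  majority_slope l p <= Num.sqrt (2 * l).+1%:R.
Proof.
move=> /andP[p0 p1]; rewrite majority_slopeE.
have /andP[_] := majority_peak l; apply: le_trans.
have a0 : 0 <= (2 * l).+1%:R * central_ratio l.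
  by rewrite mulr_ge0 ?divr_ge0 ?exprn_ge0.
have x0 : 0 <= 1 - (2 * p - 1) ^+ 2 by rewrite expr2; nra.
have x1 : 1 - (2 * p - 1) ^+ 2 <= 1 by rewrite gerBl sqr_ge0.
by rewrite ler_piMr // exprn_ile1.
Qed.

(** A Mills-ratio bound of the upper tail by the density.  The difference G of
the two sides satisfies G' = - 2(l+1)(1 - h) <= 0, because the derivative of
(p(1-p))^(l+1) cancels the contribution of h', and G(1) = 0. *)
Lemma mills_upper l p : 0 <= p <= 1 ->
  l.+1%:R * (2 * p - 1) * (1 - (majority_poly l).[p])
  <= majority_slope l p * (p * (1 - p)).
Proof.
move=> /andP[p0 p1].
pose c : R := ((2 * l).+1 * 'C(2 * l, l))%:R.
pose G : {poly R} := l.+1%:R%:P * (1 - 2%:P * 'X) * (1 - majority_poly l)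
   + c%:P * ('X * (1 - 'X)) ^+ l.+1.
have GE x : G.[x] = - (l.+1%:R * (2 * x - 1) * (1 - (majority_poly l).[x]))
    + majority_slope l x * (x * (1 - x)).
  rewrite /G !hornerE /majority_slope -/c exprSr /=; ring.
have dG x : G^`().[x] = - 2 * l.+1%:R * (1 - (majority_poly l).[x]).
  rewrite /G !poly.derivE deriv_exp !poly.derivE /= !(hornerE, hornerMn).
  by rewrite deriv_majority /majority_slope -/c -mulr_natl -!natr1; ring.
have : (- G).[p] <= (- G).[1].
  apply: (@ler_hornerW _ 0 1) => //; rewrite ?in_itv /= ?p0 ?p1 ?ler01 ?lexx //.
  move=> x; rewrite in_itv /= => /andP[x0 x1].
  have /andP[_ h1] : 0 <= (majority_poly l).[x] <= 1 by apply: majority_01; lra.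
  rewrite derivN hornerN dG !mulNr opprK !mulr_ge0 //; lra.
rewrite !hornerN !GE majority_1 !subrr; lra.
Qed.

(** The image of [mills_upper] under the symmetry p |-> 1 - p. *)
Lemma mills_lower l p : 0 <= p <= 1 ->
  l.+1%:R * (1 - 2 * p) * (majority_poly l).[p]
  <= majority_slope l p * (p * (1 - p)).
Proof.
move=> /andP[p0 p1].
have /mills_upper h : 0 <= 1 - p <= 1 by lra.
have := h l; rewrite binomial_tail_compl subKr.
have -> : majority_slope l (1 - p) = majority_slope l p.
  by rewrite /majority_slope subKr (mulrC (1 - p)).
rewrite -/(majority_poly l) !subKr (mulrC (1 - p)).
suff -> : 2 * (1 - p) - 1 = 1 - 2 * p by [].
by ring.
Qed.

(** Within 1/(2 sqrt k) of 1/2, where k = 2l+1, the slope is at least half of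
its maximum by Bernoulli's inequality; further away, the Mills-ratio bounds
give a slope of order k / sqrt k times the smaller of h and 1 - h. *)
Lemma majority_slope_lower l p delta : 0 <= p <= 1 ->
  0 < delta <= 2^-1 -> delta <= (majority_poly l).[p] <= 1 - delta ->
  Num.sqrt (2 * l).+1%:R * (delta / 2) <= majority_slope l p.
Proof.
move=> p01 /andP[d0 d2] /andP[hl hu]; have [p0 p1] := andP p01.
have /andP[peak _] := majority_peak l.
have m0 := majority_slope_ge0 l p01.
have U := mills_upper l p01; have L := mills_lower l p01.
set k : R := (2 * l).+1%:R in peak *.
have kE : k = 2 * l%:R + 1 by rewrite /k -natr1 natrM.
have l0 : 0 <= l%:R :> R by [].
have k0 : 0 < k by rewrite kE; lra.
have s0 : 0 < Num.sqrt k by rewrite sqrtr_gt0.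
have sE : Num.sqrt k ^+ 2 = k by rewrite sqr_sqrtr // ltW.
set s := Num.sqrt k in s0 sE peak *; set m := majority_slope l p in U L m0 *.
set x := 2 * p - 1.
(* The cases are a distance |p - 1/2| below, then above, 1 / (2 sqrt k). *)
case: (leP (k * x ^+ 2) 1) => hx.
  have x01 : 0 <= x ^+ 2 <= 1 by rewrite sqr_ge0 /x expr2; nra.
  have B := bernoulli_sub l x01.
  have : s / 2 * 2^-1 <= m; last by nra.
  by rewrite /m majority_slopeE -/k -/x; apply: ler_pM => //; nra.
have sx : 1 <= s * `|x|.
  rewrite -(@ler_sqr _ 1) ?nnegrE ?mulr_ge0 // ?(ltW s0) //.
  by rewrite expr1n exprMn sE real_normK ?num_real // ltW.
have ml : l.+1%:R * `|x| * delta <= m / 4.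
  have lx : 0 <= l.+1%:R :> R by [].
  have pq : m * (p * (1 - p)) <= m / 4.
    apply: ler_wpM2l => //; have : 0 <= x ^+ 2 by rewrite sqr_ge0.
    by rewrite /x expr2; lra.
  case: (leP 0 x) => x0.
    rewrite ger0_norm //; apply: le_trans pq; apply: le_trans U.
    by apply: ler_wpM2l; [rewrite mulr_ge0 | lra].
  rewrite ltr0_norm //; apply: le_trans pq; apply: le_trans L.
  have -> : 1 - 2 * p = - x by rewrite /x; ring.
  by apply: ler_wpM2l; [rewrite mulr_ge0 //; lra | lra].
have h : s ^+ 2 * `|x| * delta <= m / 2.
  have ax := normr_ge0 x.
  have : 0 <= `|x| * delta by rewrite mulr_ge0 // ltW.
  move: ml; rewrite sE kE -natr1; nra.
have : s * (s * `|x|) * delta <= m / 2 by rewrite mulrA -expr2.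
have : s * 1 * delta <= s * (s * `|x|) * delta.
  by rewrite ler_pM2r // ler_pM2l.
nra.
Qed.
End Majority.

(** * The composite threshold profile *)

Lemma deriv_tribes_prob (R : idomainType) r s (h : {poly R}) p :
  (1 - (1 - h ^+ r) ^+ s)^`().[p] =
  (r%:R * (s%:R * h.[p] ^+ r.-1 * (1 - h.[p] ^+ r) ^+ s.-1)) * h^`().[p].
Proof.
rewrite derivB derivC sub0r deriv_exp derivB derivC sub0r deriv_exp.
rewrite hornerN hornerMn hornerM hornerN hornerMn hornerM !horner_exp.
rewrite hornerD hornerN hornerC horner_exp -[_ *+ r]mulr_natl -[_ *+ s]mulr_natl; ring.
Qed.

Section Profile.
Context {R : rcfType}.
Variables (r l : nat).
Hypothesis r0 : (0 < r)%N.
Implicit Types p x y eta : R.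

(** The measure of a set of tribes of majorities, as a polynomial in p. *)
Definition profile : {poly R} := 1 - (1 - majority_poly l ^+ r) ^+ (2 ^ r).
(** The order of magnitude of the slope of [profile] at its threshold. *)
Definition sharpness : R := r%:R * Num.sqrt (2 * l).+1%:R.

Lemma horner_profile p :
  profile.[p] = tribes_prob r (2 ^ r) (majority_poly l).[p].
Proof. by rewrite /profile !hornerE. Qed.

Lemma sharpness_gt0 : 0 < sharpness.
Proof. by rewrite mulr_gt0 ?sqrtr_gt0 ?ltr0n. Qed.

Lemma deriv_profile p : profile^`().[p] =
  tribes_slope r (2 ^ r) (majority_poly l).[p] * majority_slope l p.
Proof.
by rewrite deriv_tribes_prob deriv_majority.
Qed.

Lemma profile_0 : profile.[0] = 0.
Proof.
by rewrite horner_profile majority_0 /tribes_prob expr0n gtn_eqF // subr0 expr1n subrr.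
Qed.

Lemma profile_1 : profile.[1] = 1.
Proof.
rewrite horner_profile majority_1 /tribes_prob expr1n subrr.
by rewrite expr0n gtn_eqF ?expn_gt0 // subr0.
Qed.

Lemma profile_half : 1 / 4 <= profile.[2^-1] <= 3 / 4.
Proof. by rewrite horner_profile majority_half tribes_half. Qed.

Lemma profile_nondecreasing :
  {in `[0, 1] &, {homo horner profile : x y / x <= y}}.
Proof.
apply: ler_hornerW => x; rewrite in_itv /= => /andP[x0 x1].
have x01 : 0 <= x <= 1 by lra.
by rewrite deriv_profile mulr_ge0 ?tribes_slope_ge0 ?majority_01 ?majority_slope_ge0.
Qed.

Lemma profile_slope_upper p : 0 <= p <= 1 -> profile^`().[p] <= 4 * sharpness.
Proof.
move=> p01; have h01 := majority_01 l p01.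
rewrite deriv_profile /sharpness [leRHS]mulrA; apply: ler_pM.
- exact: tribes_slope_ge0.
- exact: majority_slope_ge0.
- exact: tribes_slope_upper.
- exact: majority_slope_upper.
Qed.

Lemma profile_slope_lower p eta : 0 <= p <= 1 -> 0 < eta <= 2^-1 ->
  eta <= profile.[p] <= 1 - eta ->
  sharpness * (eta ^+ 3 / 16) <= profile^`().[p].
Proof.
move=> p01 /[dup] eta01 /andP[e0 e2]; rewrite horner_profile => lvl.
have h01 := majority_01 l p01.
have hlvl := tribes_level r0 h01 eta01 lvl.
have s0 := sqrtr_ge0 ((2 * l).+1%:R : R).
have d01 : 0 < eta ^+ 2 / 4 <= 2^-1.
  by rewrite divr_gt0 ?exprn_gt0 //= expr2; nra.
have M := majority_slope_lower p01 d01 hlvl.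
have T := tribes_slope_lower r0 (expn_gt0 2 r : 0 < 2 ^ r)%N h01.
set t := tribes_prob _ _ _ in lvl T.
have T' : r%:R * (eta / 2) <= tribes_slope r (2 ^ r) (majority_poly l).[p].
  by apply: le_trans T; rewrite ler_wpM2l //; nra.
rewrite deriv_profile /sharpness.
apply: le_trans (ler_pM _ _ T' M).
- by rewrite le_eqVlt; apply/orP; left; apply/eqP; field.
- by rewrite mulr_ge0 // divr_ge0 // ltW.
- by rewrite mulr_ge0 // ltW // divr_gt0 //; case/andP: d01.
Qed.

(** The mean value theorem: since the profile is nondecreasing, the intermediate
point lies in the same band of levels as x and y, where the slope is
controlled from both sides. *)
Lemma profile_increment x y eta : 0 <= x <= 1 -> 0 <= y <= 1 ->
  0 < eta <= 2^-1 ->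
  eta <= profile.[x] <= 1 - eta -> eta <= profile.[y] <= 1 - eta ->
  sharpness * (eta ^+ 3 / 16) * `|y - x| <= `|profile.[y] - profile.[x]|
  <= 4 * sharpness * `|y - x|.
Proof.
move=> x01 y01 e01 lx ly; wlog xy : x y x01 y01 lx ly / x < y.
  move=> H; case: (ltgtP x y) => [xy|yx|->]; first exact: H.
    by rewrite distrC (distrC profile.[_]); apply: H.
  by rewrite !subrr !normr0 !mulr0 lexx.
have [x0 x1] := andP x01; have [y0 y1] := andP y01.
have [z] := poly_mvt profile xy; rewrite in_itv /= => /andP[xz zy] ->.
have z01 : 0 <= z <= 1 by lra.
have lz : eta <= profile.[z] <= 1 - eta.
  have [l1 _] := andP lx; have [_ l2] := andP ly.
  have z_ : z \in `[0, 1] by rewrite in_itv.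
  rewrite (le_trans l1) ?(le_trans _ l2) //.
  - by apply: profile_nondecreasing; rewrite ?in_itv //= ltW.
  - by apply: profile_nondecreasing; rewrite ?in_itv //= ltW.
have L := profile_slope_lower z01 e01 lz; have U := profile_slope_upper z01.
have [e0 _] := andP e01.
have d0 : 0 <= profile^`().[z].
  by apply: le_trans L; rewrite mulr_ge0 ?(ltW sharpness_gt0) // divr_ge0 // exprn_ge0 // ltW.
by rewrite normrM (ger0_norm d0) !ler_wpM2r.
Qed.

Lemma profile_level alpha : 0 <= alpha <= 1 ->
  exists2 p : R, 0 <= p <= 1 & profile.[p] = alpha.
Proof.
move=> /andP[a0 a1]; move: profile profile_0 profile_1 => F F0 F1.
have [||p] := @poly_ivtW R (F - alpha%:P) 0 1; rewrite ?ler01 //.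
  by rewrite !hornerE F0 F1 sub0r oppr_le0 subr_ge0 a0.
by move=> p01; rewrite rootE !hornerE subr_eq0 => /eqP; exists p.
Qed.
End Profile.

(** * Product measures of composed events *)

Section ProductMass.
Context {R : comNzRingType} (p : R).
Implicit Types I J T : finType.

Definition bernoulli_weight (b : bool) : R := if b then p else 1 - p.

(** The counterpart of [mu] for a cube indexed by an arbitrary finite type, so
that products of index types can be used to describe composed events. *)
Definition product_mass T (A : pred {ffun T -> bool}) : R :=
  \sum_(x | A x) \prod_t bernoulli_weight (x t).

Lemma product_mass_total T : product_mass (@predT {ffun T -> bool}) = 1.
Proof.
rewrite /product_mass -(bigA_distr_bigA (fun _ : T => bernoulli_weight)) big1 //.
by move=> t _; rewrite big_bool /= addrC subrK.
Qed.

Lemma product_mass_compl T (A : pred {ffun T -> bool}) :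
  product_mass (predC A) = 1 - product_mass A.
Proof.
apply/eqP; rewrite eq_sym subr_eq addrC -(product_mass_total T) /product_mass.
by rewrite (bigID A) /=.
Qed.

(** The rows of a configuration indexed by I * J are independent. *)
Lemma product_mass_forall I J (A : pred {ffun J -> bool}) :
  product_mass (fun x : {ffun I * J -> bool} =>
     [forall i, A [ffun j => x (i, j)]]) = product_mass A ^+ #|I|.
Proof.
rewrite -prodr_const /product_mass.
rewrite (bigA_distr_big A (fun (_ : I) (y : {ffun J -> bool}) =>
  \prod_j bernoulli_weight (y j))).
rewrite (reindex (fun f : {ffun I -> {ffun J -> bool}} =>
  [ffun t : I * J => f t.1 t.2])) /=; last first.
  exists (fun x : {ffun I * J -> bool} => [ffun i => [ffun j => x (i, j)]]).
    by move=> f _; apply/ffunP => i; apply/ffunP => j; rewrite !ffunE.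
  by move=> x _; apply/ffunP => -[i j]; rewrite !ffunE.
apply: eq_big => [f|f _]; last first.
  by rewrite pair_big; apply: eq_bigr => -[i j] _; rewrite ffunE.
apply: eq_forallb => i; congr (A _).
by apply/ffunP => j; rewrite !ffunE.
Qed.

Lemma product_mass_exists I J (A : pred {ffun J -> bool}) :
  product_mass (fun x : {ffun I * J -> bool} =>
     [exists i, A [ffun j => x (i, j)]]) = 1 - (1 - product_mass A) ^+ #|I|.
Proof.
rewrite -product_mass_compl -product_mass_forall -product_mass_compl.
apply: eq_bigl => x /=; rewrite negb_forall.
by apply: eq_existsb => i /=; rewrite negbK.
Qed.

Definition weight_above T m (x : {ffun T -> bool}) := (m < #|[set t | x t]%SET|)%N.

(** The configurations are grouped by their number of ones; there are
'C(#|T|, j) configurations with j ones. *)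
Lemma product_mass_above T m :
  product_mass (@weight_above T m) = (binomial_tail #|T| m.+1).[p].
Proof.
rewrite horner_binomial_tail /product_mass.
rewrite (reindex (fun S : {set T} => [ffun t => t \in S])) /=; last first.
  exists (fun x : {ffun T -> bool} => [set t | x t]%SET).
    by move=> S _; apply/setP => t; rewrite inE ffunE.
  by move=> x _; apply/ffunP => t; rewrite ffunE inE.
pose g j : R := p ^+ j * (1 - p) ^+ (#|T| - j).
transitivity (\sum_(S : {set T} | (m < #|S|)%N) g #|S|).
  apply: eq_big => S.
    by rewrite /weight_above; congr (_ < #|pred_of_set _|)%N; apply/setP => t;
       rewrite inE ffunE.
  move=> _; rewrite (bigID (mem S)) /= /g; congr (_ * _).
    by rewrite -prodr_const; apply: eq_bigr => t tS; rewrite ffunE tS.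
  rewrite -(cardsC S) addKn -prodr_const.
  by apply: eq_big => [t|t tS]; rewrite ?inE // ffunE (negbTE tS).
have ltS (S : {set T}) : (#|S| < #|T|.+1)%N by rewrite ltnS max_card.
rewrite (partition_big (fun S => Ordinal (ltS S))
  (fun j : 'I_(#|T|.+1) => m < j)%N) //=.
rewrite (big_nat_widenl _ 0) // big_mkord; apply: eq_big => // j mj.
transitivity (\sum_(S in [set S : {set T} | #|S| == j]%SET) g j).
  apply: eq_big => S; rewrite ?inE -?val_eqE /=.
    by case: eqP => [->|]; rewrite ?mj ?andbF.
  by move=> /andP[_ /eqP->].
by rewrite sumr_const card_draws.
Qed.

End ProductMass.

(** * Events as subsets of the cube, and their symmetries *)

Section Transfer.
Variable T : finType.

Definition cube_event (A : pred {ffun T -> bool}) : {set cube #|T|} :=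
  [set x : cube #|T| | A [ffun t => x (enum_rank t)]]%SET.

Lemma mu_cube_event (R : realType) (p : R) (A : pred {ffun T -> bool}) :
  mu p (cube_event A) = product_mass p A.
Proof.
rewrite /mu /product_mass.
rewrite [RHS](reindex (fun x : cube #|T| => [ffun t => x (enum_rank t)])) /=; last first.
  exists (fun x : {ffun T -> bool} => [ffun i => x (enum_val i)]).
    by move=> x _; apply/ffunP => i; rewrite !ffunE enum_valK.
  by move=> x _; apply/ffunP => t; rewrite !ffunE enum_rankK.
apply: eq_big => [x|x _]; first by rewrite inE.
rewrite /mu_pt -!prodrXr -big_split /=.
rewrite (reindex (@enum_rank T)) /=; last first.
  by apply: onW_bij; exact: enum_rank_bij.
apply: eq_bigr => t _; rewrite ffunE /bernoulli_weight.
by case: (x _); rewrite ?expr1 ?expr0 ?mul1r ?mulr1.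
Qed.

Lemma monotone_cube_event (A : pred {ffun T -> bool}) :
  (forall x y : {ffun T -> bool}, (forall t, x t -> y t) -> A x -> A y) ->
  monotone_set (cube_event A).
Proof.
move=> mA x y; rewrite !inE => Ax xy; apply: mA Ax => t; rewrite !ffunE.
by have := xy (enum_rank t); do 2 case: (_ (enum_rank t)).
Qed.

(** The group is the full stabilizer of the event, so transitivity only needs,
for each pair of coordinates, one symmetry of the event that moves the first
to the second; involutions suffice here and make the inverse in [perm_cube]
harmless. *)
Lemma symmetric_cube_event (t0 : T) (A : pred {ffun T -> bool}) :
  (forall t u, exists f : T -> T, [/\ involutive f, f t = u &
     forall x : {ffun T -> bool}, A [ffun v => x (f v)] = A x]) ->
  symmetric_set (cube_event A).
Proof.
move=> trA; pose C := cube_event A.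
pose S := [set g : {perm 'I_#|T|} |
  [forall x, (perm_cube g x \in C) == (x \in C)]]%SET.
have SP (g : {perm 'I_#|T|}) : reflect (forall x, (perm_cube g x \in C) = (x \in C)) (g \in S).
  by rewrite inE; exact: 'forall_eqP.
have gS : group_set S.
  apply/group_setP; split.
    apply/SP => x; suff -> : perm_cube 1%g x = x by []; apply/ffunP => i.
    by rewrite ffunE invg1 perm1.
  move=> g h /SP Sg /SP Sh; apply/SP => x.
  suff -> : perm_cube (g * h)%g x = perm_cube h (perm_cube g x).
    by rewrite Sh Sg.
  by apply/ffunP => i; rewrite !ffunE invMg permM.
exists (group gS); split; last by move=> g x /SP ->.
have trS i j : exists2 g, g \in S & g i = j.
  have [f [fK fij fA]] := trA (enum_val i) (enum_val j).
  have hK : involutive (fun k : 'I_#|T| => enum_rank (f (enum_val k))).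
    by move=> k; rewrite enum_rankK fK enum_valK.
  exists (perm (can_inj hK)); last by rewrite permE fij enum_valK.
  apply/SP => x; rewrite !inE -[in RHS]fA; congr (A _); apply/ffunP => t.
  rewrite !ffunE; congr (x _); apply: (@perm_inj _ (perm (can_inj hK))).
  by rewrite permKV permE enum_rankK fK.
apply/imsetP; exists (enum_rank t0); rewrite ?inE //.
apply/esym/setP => j; rewrite inE; apply/orbitP.
by have [g Sg gj] := trS (enum_rank t0) j; exists g.
Qed.

End Transfer.

(** * Tribes of majorities as symmetric subsets of the cube *)

Section Tribes.
Variables (r l : nat).

Definition tribe_index : finType := ('I_(2 ^ r) * ('I_r * 'I_(2 * l).+1))%type.

Definition tribes_of_majorities (x : {ffun tribe_index -> bool}) : bool :=
  [exists a, forall b,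
     weight_above l [ffun c => [ffun u => x (a, u)] (b, c)]].

Lemma mass_tribes_of_majorities (R : rcfType) (p : R) :
  product_mass p tribes_of_majorities =
  tribes_prob r (2 ^ r) (majority_poly l).[p].
Proof.
rewrite (product_mass_exists p 'I_(2 ^ r)
  (fun y : {ffun 'I_r * 'I_(2 * l).+1 -> bool} =>
     [forall b, weight_above l [ffun c => y (b, c)]])).
by rewrite product_mass_forall product_mass_above !card_ord.
Qed.

End Tribes.

Section TribesCube.
Variables (r l : nat).
Hypothesis r0 : (0 < r)%N.

Definition tribes_cube := cube_event (@tribes_of_majorities r l).

Lemma mu_tribes_cube (R : realType) (p : R) :
  mu p tribes_cube = tribes_prob r (2 ^ r) (majority_poly l).[p].
Proof. by rewrite mu_cube_event mass_tribes_of_majorities. Qed.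

Lemma monotone_tribes_cube : monotone_set tribes_cube.
Proof.
apply: monotone_cube_event => x y xy /existsP[a /forallP h].
apply/existsP; exists a; apply/forallP => b; apply: leq_trans (h b) _.
by apply: subset_leq_card; apply/fintype.subsetP => c; rewrite !inE !ffunE; apply: xy.
Qed.

(** Tribes, committees in a tribe, and voters in a committee can be exchanged
independently by transpositions. *)
Lemma symmetric_tribes_cube : symmetric_set tribes_cube.
Proof.
have lt0 : (0 < 2 ^ r)%N by rewrite expn_gt0.
apply: (symmetric_cube_event (Ordinal lt0, (Ordinal r0, ord0))) => -[a [b c]] [a' [b' c']].
pose f (t : tribe_index r l) : tribe_index r l :=
  (tperm a a' t.1, (tperm b b' t.2.1, tperm c c' t.2.2)).
exists f; split; first by move=> [? [? ?]]; rewrite /f /= !tpermK.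
  by rewrite /f /= !tpermL.
have tpermP (U : finType) (u v : U) (P : pred U) :
    [forall w, P (tperm u v w)] = [forall w, P w].
  apply/forallP/forallP => h w; last exact: h.
  by rewrite -(tpermK u v w).
move=> x; rewrite /tribes_of_majorities; apply: negb_inj; rewrite !negb_exists.
rewrite -[RHS](tpermP _ a a'); apply: eq_forallb => i; congr (~~ _).
rewrite -[RHS](tpermP _ b b'); apply: eq_forallb => j.
rewrite /weight_above -[in RHS](card_preimset _ (@perm_inj _ (tperm c c'))).
congr (l < #|pred_of_set _|)%N; apply/setP => k.
by rewrite !inE !ffunE.
Qed.

Lemma nontrivial_tribes_cube : nontrivial_set tribes_cube.
Proof.
split => /setP.
  move=> /(_ [ffun _ => true]); rewrite !inE => /negbT/negP; apply.
  apply/existsP; exists (Ordinal (expn_gt0 2 r : 0 < 2 ^ r)%N).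
  apply/forallP => b; rewrite /weight_above (_ : [set _ | _]%SET = [set: _]%SET).
    by rewrite cardsT card_ord ltnS mul2n -addnn leq_addr.
  by apply/setP => c; rewrite !inE !ffunE.
move=> /(_ [ffun _ => false]); rewrite !inE => /idP/existsP[a /forallP].
move=> /(_ (Ordinal r0)); rewrite /weight_above (_ : [set _ | _]%SET = finset.set0).
  by rewrite cards0.
by apply/setP => c; rewrite !inE !ffunE.
Qed.

Lemma card_tribe_index : #|tribe_index r l| = (2 ^ r * (r * (2 * l).+1))%N.
Proof. by rewrite !card_prod !card_ord. Qed.

End TribesCube.

(** * Choice of the parameters *)

Lemma ln_pow2_ge (R : realType) (m : nat) : m%:R / 2 <= ln ((2 ^ m)%:R : R).
Proof.
have h : ln (2^-1 : R) <= - 2^-1.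
  have := @le_ln1Dx R (- 2^-1); have -> : 1 + - 2^-1 = 2^-1 :> R by field.
  by apply; lra.
rewrite lnV ?posrE // in h.
rewrite natrX lnXn // -[leRHS]mulr_natl ler_wpM2l //; lra.
Qed.

(** The least r with r / 2^r <= w^2 / 2^m works.  If r > 1, then r - 1 fails,
which is the upper bound since r / 2^r at most halves from r - 1 to r; if
r = 1, the upper bound is w^2 <= 2^m.  The hypothesis m/2 <= w
ensures r <= m, hence r 2^r <= 2 r^2 2^m / w^2 <= 8 2^m. *)
Lemma tribe_size_exists (R : realFieldType) (m : nat) (w : R) :
  (4 <= m)%N -> m%:R / 2 <= w -> w ^+ 2 <= (2 ^ m)%:R ->
  exists r, [/\ (0 < r)%N, (r * 2 ^ r <= 8 * 2 ^ m)%N &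
    r%:R * (2 ^ m)%:R <= (2 ^ r)%:R * w ^+ 2 <= 2 * (r%:R * (2 ^ m)%:R)].
Proof.
move=> m4 mw wM.
pose P r := (0 < r)%N && (r%:R * (2 ^ m)%:R <= (2 ^ r)%:R * w ^+ 2).
have M0 : 0 < (2 ^ m)%:R :> R by rewrite ltr0n expn_gt0.
have m4R : 4 <= m%:R :> R by rewrite (ler_nat R 4).
have w2 : m%:R ^+ 2 / 4 <= w ^+ 2 by rewrite !expr2; nra.
have Pm : P m.
  rewrite /P (leq_trans _ m4) //= mulrC ler_wpM2l //.
  by apply: le_trans w2; rewrite expr2; nra.
case: (ex_minnP (ex_intro _ m Pm)) => r /andP[r0 lo] rmin.
have rm : (r <= m)%N by exact: rmin.
have hi : (2 ^ r)%:R * w ^+ 2 <= 2 * (r%:R * (2 ^ m)%:R).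
  case: r r0 lo rmin rm => // -[|r] _ _ rmin _; first by rewrite mul1r expn1; lra.
  have : ~~ P r.+1 by apply/negP => /rmin; rewrite ltnn.
  rewrite /P /= -ltNge [(2 ^ r.+2)%N]expnS natrM -[r.+2%:R]natr1 => h; lra.
exists r; split; rewrite ?lo //.
rewrite -(ler_nat R) !natrM.
have rmR : r%:R <= m%:R :> R by rewrite ler_nat.
have rR : 0 <= r%:R :> R by [].
set X := (2 ^ r)%:R in lo hi *; set M := (2 ^ m)%:R in M0 lo hi *.
have X0 : 0 <= X by rewrite /X.
have m2 : 0 < m%:R ^+ 2 / 4 :> R by rewrite divr_gt0 // exprn_gt0 //; lra.
rewrite -(ler_pM2r m2).
apply: (@le_trans _ _ (r%:R * X * w ^+ 2)); first by rewrite ler_wpM2l // mulr_ge0.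
apply: (@le_trans _ _ (r%:R * (2 * (r%:R * M)))).
  by rewrite -mulrA ler_wpM2l.
have : r%:R ^+ 2 <= m%:R ^+ 2 :> R by rewrite ler_sqr ?nnegrE.
rewrite !expr2; nra.
Qed.

Lemma compare_of_sqr (R : realFieldType) (x y : R) : 0 < x -> 0 < y ->
  x ^+ 2 <= 2 * y ^+ 2 -> y ^+ 2 <= 10 * x ^+ 2 -> x / 2 <= y <= 4 * x.
Proof.
rewrite !expr2 => x0 y0 h1 h2.
by apply/andP; split; rewrite leNgt; apply/negP => h; nra.
Qed.

Lemma sharpness_sqr (R : rcfType) r l : (0 < r)%N ->
  (2 ^ r)%:R * sharpness r l ^+ 2 =
  r%:R * (2 ^ r * (r * (2 * l).+1))%:R :> R.
Proof.
by move=> r0; rewrite /sharpness exprMn sqr_sqrtr // !natrM; ring.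
Qed.

Section Scale.
Context {R : realType} (c : nat -> R).
Hypothesis c_pos : forall n, (0 < n)%N -> 0 < c n.
Hypothesis c_nondecreasing :
  forall m n, (0 < m)%N -> (m <= n)%N -> c m <= c n.
Hypothesis c_bounds : forall n, (0 < n)%N ->
  ln (n%:R : R) <= c n <= Num.sqrt (n%:R : R).
Hypothesis c_double : Theta_seq (fun n => c (2 * n)%N) c.

Lemma c_pow16_ge n : 2 * n%:R <= c (16 ^ n)%N.
Proof.
have /andP[h _] : ln ((16 ^ n)%:R : R) <= c (16 ^ n)%N <= Num.sqrt (16 ^ n)%:R.
  by apply: c_bounds; rewrite expn_gt0.
apply: le_trans h; have -> : (16 ^ n = 2 ^ (4 * n))%N by rewrite expnM.
by apply: le_trans (ln_pow2_ge _ _); rewrite natrM; lra.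
Qed.

Lemma parameters_exist n : (0 < n)%N -> exists rl : nat * nat,
  [/\ (0 < rl.1)%N,
      (16 ^ n < 2 ^ rl.1 * (rl.1 * (2 * rl.2).+1) <= 10 * 16 ^ n)%N &
      c (16 ^ n)%N / 2 <= sharpness rl.1 rl.2 <= 4 * c (16 ^ n)%N].
Proof.
move=> n0; have e16 : (16 ^ n = 2 ^ (4 * n))%N by rewrite expnM.
have M0 : (0 < 16 ^ n)%N by rewrite expn_gt0.
set w := c (16 ^ n)%N.
have w0 : 0 < w by exact: c_pos.
have w2 : w ^+ 2 <= (2 ^ (4 * n))%:R.
  have /andP[_ h] := c_bounds M0; rewrite -e16 -[leRHS]sqr_sqrtr //.
  by rewrite ler_sqr ?nnegrE ?sqrtr_ge0 // ltW.
have m4 : (4 <= 4 * n)%N by rewrite leq_pmulr.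
have mw : (4 * n)%:R / 2 <= w.
  by have := c_pow16_ge n; rewrite -/w natrM; lra.
have [r [r0 size_r]] := tribe_size_exists m4 mw w2.
rewrite -e16 in size_r *; move=> /andP[lo hi].
set B := (r * 2 ^ r)%N in size_r.
have B0 : (0 < B)%N by rewrite muln_gt0 r0 expn_gt0.
(* With this l, the size B (2l+1) exceeds 16 ^ n and is at most 2 16 ^ n + B. *)
pose l := (16 ^ n %/ B)%N; exists (r, l) => /=.
have NE : (2 ^ r * (r * (2 * l).+1) = B * (2 * l).+1)%N by rewrite /B; lia.
have l1 : (l * B <= 16 ^ n)%N by exact: leq_divM.
have l2 : (16 ^ n < l.+1 * B)%N by exact: ltn_ceil.
have N1 : (16 ^ n < 2 ^ r * (r * (2 * l).+1))%N by rewrite NE; nia.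
have N2 : (2 ^ r * (r * (2 * l).+1) <= 10 * 16 ^ n)%N by rewrite NE; nia.
split; rewrite ?N1 //.
have := sharpness_sqr R l r0; have := @sharpness_gt0 R r l r0.
set S := sharpness r l => S0 SE.
have X0 : 0 < (2 ^ r)%:R :> R by rewrite ltr0n expn_gt0.
have rR : 0 <= r%:R :> R by [].
have N1R : (16 ^ n)%:R <= (2 ^ r * (r * (2 * l).+1))%:R :> R by rewrite ler_nat ltnW.
have N2R : (2 ^ r * (r * (2 * l).+1))%:R <= 10 * (16 ^ n)%:R :> R.
  by rewrite -natrM ler_nat.
have S1 : w ^+ 2 <= 2 * S ^+ 2.
  rewrite -(ler_pM2l X0) [leRHS]mulrCA SE; apply: le_trans hi _.
  by rewrite ler_pM2l // ler_wpM2l.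
have S2 : S ^+ 2 <= 10 * w ^+ 2.
  rewrite -(ler_pM2l X0) SE [leRHS]mulrCA.
  apply: (@le_trans _ _ (10 * (r%:R * (16 ^ n)%:R))); last by rewrite ler_pM2l.
  by rewrite mulrCA ler_wpM2l.
exact: compare_of_sqr.
Qed.

(** Four doublings lead from 16 ^ n to 16 ^ n.+1. *)
Lemma c_comparable : exists K : R, exists n1 : nat, [/\ 1 <= K, (0 < n1)%N &
  forall n k, (n1 <= n)%N -> (16 ^ n <= k <= 16 * 16 ^ n)%N ->
    c (16 ^ n)%N <= c k <= K * c (16 ^ n)%N].
Proof.
have [c1 [c2 [c1_0 c12 [n0 dbl]]]] := c_double.
have c20 : 0 <= c2 by lra.
exists (1 + c2 ^+ 4), n0.+1; split => //.
  by rewrite lerDl exprn_ge0.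
move=> n k nn /andP[k1 k2].
have M0 : (0 < 16 ^ n)%N by rewrite expn_gt0.
have nM : (n0 <= 16 ^ n)%N.
  by apply: leq_trans (ltnW nn) _; apply: ltnW; exact: ltn_expl.
rewrite c_nondecreasing //=.
apply: (@le_trans _ _ (c (16 * 16 ^ n)%N)).
  by apply: c_nondecreasing => //; apply: leq_trans k1.
have step (x : nat) : (n0 <= x)%N -> c (2 * x)%N <= c2 * c x.
  by move=> /dbl /andP[].
have d1 := step _ nM.
have d2 : c (2 * (2 * 16 ^ n))%N <= c2 * c (2 * 16 ^ n)%N by apply: step; lia.
have d3 : c (2 * (2 * (2 * 16 ^ n)))%N <= c2 * c (2 * (2 * 16 ^ n))%N.
  by apply: step; lia.
have d4 : c (2 * (2 * (2 * (2 * 16 ^ n))))%N <= c2 * c (2 * (2 * (2 * 16 ^ n)))%N.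
  by apply: step; lia.
have -> : (16 * 16 ^ n = 2 * (2 * (2 * (2 * 16 ^ n))))%N by lia.
apply: (@le_trans _ _ (c2 ^+ 4 * c (16 ^ n)%N)); last first.
  by rewrite mulrDl mul1r lerDr ltW // c_pos.
apply: le_trans d4 _; rewrite exprS -mulrA ler_wpM2l //.
apply: le_trans d3 _; rewrite exprS -mulrA ler_wpM2l //.
apply: le_trans d2 _; rewrite exprS -mulrA ler_wpM2l //.
Qed.
End Scale.

(** * Levels and widths *)

Section Levels.
Context {R : realType} (r l : nat).
Hypothesis r0 : (0 < r)%N.
Implicit Types alpha eps eta : R.

Lemma p_level_tribes alpha : 0 <= alpha <= 1 ->
  0 <= p_level (tribes_cube r l) alpha <= 1 /\
  (profile r l).[p_level (tribes_cube r l) alpha] = alpha.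
Proof.
move=> a01; pose S := [set p : R | 0 <= p <= 1 /\ mu p (tribes_cube r l) = alpha].
have : S (p_level (tribes_cube r l) alpha).
  apply: getPex; have [p p01 pa] := profile_level l r0 a01.
  by exists p; split => //; rewrite mu_tribes_cube -horner_profile.
by rewrite /S /= mu_tribes_cube -horner_profile.
Qed.

(** F(1/2) lies in [1/4, 3/4], so F(1/2) and alpha are two levels of the band
between eta and 1 - eta. *)
Lemma p_level_near_half alpha eta : 0 < eta <= 4^-1 ->
  eta <= alpha <= 1 - eta ->
  sharpness r l * (eta ^+ 3 / 16) * `|2^-1 - p_level (tribes_cube r l) alpha| <= 1.
Proof.
move=> /andP[e0 e4] /andP[ea ae].
have a01 : 0 <= alpha <= 1 by lra.
have [p01 pE] := p_level_tribes a01.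
set p := p_level _ _ in p01 pE *.
have h01 : 0 <= (2^-1 : R) <= 1 by lra.
have e01 : 0 < eta <= 2^-1 by lra.
have /andP[h1 h2] := profile_half (R := R) l r0.
have lp : eta <= (profile r l).[p] <= 1 - eta by rewrite pE ea.
have lh : eta <= (profile r l).[2^-1] <= 1 - eta by lra.
have /andP[h _] := profile_increment r0 p01 h01 e01 lp lh.
apply: le_trans h _; rewrite pE ler_norml; lra.
Qed.

Lemma width_tribes eps : 0 < eps < 2^-1 ->
  let S := sharpness r l : R in
  S * (eps ^+ 3 / 16) * threshold_width (tribes_cube r l) eps <= 1 - 2 * eps /\
  1 - 2 * eps <= 4 * S * threshold_width (tribes_cube r l) eps.
Proof.
move=> /andP[e0 e2] S; rewrite /threshold_width.
have e01 : 0 <= eps <= 1 by lra.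
have e01' : 0 <= 1 - eps <= 1 by lra.
have [x01 xE] := p_level_tribes e01; have [y01 yE] := p_level_tribes e01'.
set x := p_level _ eps in x01 xE *; set y := p_level _ (1 - eps) in y01 yE *.
have xy : x <= y.
  case: (leP x y) => // yx.
  have := @profile_nondecreasing R r l y x; rewrite !in_itv /= y01 x01 => h.
  by have := h isT isT (ltW yx); rewrite xE yE; lra.
have e02 : 0 < eps <= 2^-1 by lra.
have lx : eps <= (profile r l).[x] <= 1 - eps by rewrite xE; lra.
have ly : eps <= (profile r l).[y] <= 1 - eps by rewrite yE; lra.
have /andP[] := profile_increment r0 x01 y01 e02 lx ly.
rewrite xE yE (ger0_norm (_ : 0 <= y - x)) ?subr_ge0 // ger0_norm; last by lra.
rewrite -/S => h1 h2; lra.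
Qed.
End Levels.

Theorem theorem4p1 (R : realType) (c : nat -> R)
  (c_pos : forall n : nat, (0 < n)%N -> 0 < c n)
  (c_nondecreasing : forall m n : nat, (0 < m)%N -> (m <= n)%N -> c m <= c n)
  (c_bounds : forall n : nat, (0 < n)%N ->
     ln (n%:R : R) <= c n <= Num.sqrt (n%:R : R))
  (c_double : Theta_seq (fun n : nat => c (2 * n)%N) c) :
  exists (N : nat -> nat) (C : forall n : nat, {set cube (N n)}),
    [/\ forall m n : nat, (0 < m)%N -> (m < n)%N -> (N m < N n)%N,
        forall n : nat, (0 < n)%N ->
          [/\ nontrivial_set (C n), monotone_set (C n) & symmetric_set (C n)],
        forall eps : R, 0 < eps < 1 ->
          (fun n : nat => p_level (C n) eps) @ \oo --> (2^-1 : R)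
      & forall eps : R, 0 < eps < 2^-1 ->
          Theta_seq (fun n : nat => threshold_width (C n) eps)
                    (fun n : nat => (c (N n))^-1)].
Proof.
have params n : exists rl : nat * nat, (0 < n)%N ->
    [/\ (0 < rl.1)%N,
        (16 ^ n < #|tribe_index rl.1 rl.2| <= 10 * 16 ^ n)%N &
        c (16 ^ n)%N / 2 <= sharpness rl.1 rl.2 <= 4 * c (16 ^ n)%N].
  case: (posnP n) => [->|n0]; first by exists (0%N, 0%N).
  have [rl H] := parameters_exist c_pos c_bounds n0; exists rl => _.
  by rewrite card_tribe_index.
have [rl {}params] := choice params.
exists (fun n => #|tribe_index (rl n).1 (rl n).2|).
exists (fun n => tribes_cube (rl n).1 (rl n).2).
split.
- move=> m n m0 mn; have n0 : (0 < n)%N by exact: ltn_trans mn.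
  have [_ /andP[_ hm] _] := params m m0; have [_ /andP[hn _] _] := params n n0.
  apply: leq_ltn_trans hm _; apply: leq_ltn_trans hn.
  apply: (@leq_trans (16 ^ m.+1)); last by rewrite leq_exp2l.
  by rewrite expnS leq_mul2r orbT.
- move=> n /params[r0 _ _]; split.
  + exact: nontrivial_tribes_cube.
  + exact: monotone_tribes_cube.
  + exact: symmetric_tribes_cube.
- move=> eps /andP[e0 e1].
  pose eta := Num.min (4^-1 : R) (Num.min eps (1 - eps)).
  have eta0 : 0 < eta <= 4^-1.
    by rewrite !lt_min ge_min lexx andbT; apply/and3P; split; lra.
  have [eta_eps eta_eps'] : eta <= eps /\ eta <= 1 - eps.
    by rewrite !ge_min !lexx !orbT.
  have eta_lvl : eta <= eps <= 1 - eta by lra.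
  have k0 : 0 < eta ^+ 3 / 16 by rewrite divr_gt0 // exprn_gt0 //; case/andP: eta0.
  set k := _ / _ in k0.
  apply/cvgrPdist_le => d d0.
  (* As S >= n, the bound S k D <= 1 forces D <= d as soon as n >= 1 / (k d). *)
  exists (Num.bound (k * d)^-1).+1 => // n /= bn.
  have n0 : (0 < n)%N by exact: leq_trans bn.
  have [r0 _ /andP[S1 _]] := params n n0.
  have := p_level_near_half (R := R) (rl n).2 r0 eta0 eta_lvl.
  have cn := c_pow16_ge c_bounds n; rewrite -/k.
  set S := sharpness _ _ in S1 *; set D := `|_|.
  have nS : n%:R <= S by lra.
  have kd0 : 0 < k * d by rewrite mulr_gt0.
  have nd : 1 <= n%:R * (k * d).
    rewrite -ler_pdivrMr // div1r.
    apply: ltW; apply: lt_le_trans (archi_boundP _) _.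
      by rewrite invr_ge0 ltW.
    by rewrite ler_nat ltnW.
  move=> SD; rewrite leNgt; apply/negP => dD.
  have : n%:R * (k * d) < S * k * D.
    rewrite -mulrA; apply: (@le_lt_trans _ _ (S * (k * d))).
      by rewrite ler_wpM2r // ltW.
    by rewrite ltr_pM2l ?ltr_pM2l //; exact: sharpness_gt0.
  lra.
- move=> eps /[dup] eps_int /andP[e0 e2].
  have [K [n1 [K1 n1_0 cmp]]] := c_comparable c_pos c_nondecreasing c_double.
  have k0 : 0 < eps ^+ 3 / 16 by rewrite divr_gt0 // exprn_gt0.
  set k := _ / _ in k0.
  pose a := (1 - 2 * eps) / 16.
  pose b := 2 * K * (1 - 2 * eps) / k.
  have a0 : 0 < a by rewrite divr_gt0 //; lra.
  have b0 : 0 < b.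
    rewrite divr_gt0 //; apply: mulr_gt0; lra.
  (* The summand a in the upper constant only makes the two constants ordered. *)
  exists a, (a + b); split; [by []| lra|exists n1 => n nn].
  have n0 : (0 < n)%N by exact: leq_trans nn.
  have [r0 /andP[N1 N2] /andP[S1 S2]] := params n n0.
  have /andP[c1 c2] : c (16 ^ n)%N <= c #|tribe_index (rl n).1 (rl n).2|
      <= K * c (16 ^ n)%N.
    apply: cmp => //; rewrite (ltnW N1) /=; apply: leq_trans N2 _.
    by rewrite leq_mul2r orbT.
  have [W1 W2] := width_tribes (rl n).2 r0 eps_int.
  have cM : 0 < c (16 ^ n)%N by apply: c_pos; rewrite expn_gt0.
  set w := c (16 ^ n)%N in S1 S2 c1 c2 cM.
  set v := c _ in c1 c2 *.
  rewrite -/k in W1.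
  set S := sharpness _ _ in S1 S2 W1 W2; set t := threshold_width _ _ in W1 W2 *.
  have v0 : 0 < v by lra.
  have vK : v <= 2 * K * S by nra.
  have S0 : 0 < S by exact: sharpness_gt0.
  have t0 : 0 < t by rewrite -(pmulr_rgt0 _ (_ : 0 < 4 * S)); lra.
  rewrite !ler_pdivrMr ?ler_pdivlMr //; apply/andP; split.
    by rewrite /a; nra.
  apply: (@le_trans _ _ b); last by lra.
  rewrite /b ler_pdivlMr //.
  have -> : t * v * k = k * t * v by ring.
  apply: (@le_trans _ _ (k * t * (2 * K * S))).
    by rewrite ler_wpM2l // mulr_ge0 // ltW.
  have -> : k * t * (2 * K * S) = 2 * K * (S * k * t) by ring.
  by rewrite ler_wpM2l //; lra.
Qed.
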